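(* Let $p$ be an odd prime and $r$ a positive integer. Then \[ \sum_{\substack{i+j+k=2p^{r}\\ i,j,k\in \mathcal{P}_{p}}}\frac{(-1)^{i}}{ijk}\equiv p^{r-1}B_{p-3} \pmod{p^{r}}. \]
   Context: $\mathcal{P}_{n}$ denotes the set of positive integers coprime to $n$; the sum runs over ordered triples of positive integers $(i,j,k)$, each coprime to $p$, with $i+j+k=2p^r$. The Bernoulli numbers $B_k$ are defined by $B_0=1$ and $\sum_{i=0}^{n}\binom{n+1}{i}B_{i}=0$ for $n\geq 1$. Congruences between rational numbers whose denominators are coprime to $p$ are understood in the ring of $p$-integral rationals: $a\equiv b \pmod{p^s}$ means $(a-b)/p^s$ has denominator coprime to $p$. *)

(* Defs.v *)
From mathcomp Require Export all_boot all_order all_algebra.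

Set Implicit Arguments.
Unset Strict Implicit.
Unset Printing Implicit Defensive.

Import Order.TTheory GRing.Theory Num.Theory.
Local Open Scope ring_scope.

Definition coprime_pos (n : nat) : pred nat :=
  [pred m | (0 < m)%N && coprime m n].

(* [:: B_0; ...; B_(n-1)]; each new term is obtained by solving the defining
   recurrence for its last summand 'C(n.+1, n) B_n = (n + 1) B_n. *)
Fixpoint bernoulli_seq (n : nat) : seq rat :=
  if n is m.+1 then
    let s := bernoulli_seq m in
    rcons s (if m is 0 then 1
             else - (m.+1%:R)^-1 * \sum_(i < m) 'C(m.+1, i)%:R * s`_i)
  else [::].

Definition bernoulli (n : nat) : rat := (bernoulli_seq n.+1)`_n.

Definition p_integral (p : nat) (x : rat) : bool := coprime `|denq x|%N p.

Definition eqmodp (p s : nat) (a b : rat) : bool :=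
  p_integral p ((a - b) / (p ^ s)%N%:R).

Lemma size_bernoulli_seq n : size (bernoulli_seq n) = n.
Proof. by elim: n => //= n IH; rewrite size_rcons IH. Qed.

Lemma nth_bernoulli_seq n i : (i < n)%N -> (bernoulli_seq n)`_i = bernoulli i.
Proof.
elim: n => // n IH; rewrite ltnS leq_eqVlt => /orP[/eqP-> //|lin].
by rewrite /= nth_rcons size_bernoulli_seq lin IH.
Qed.

Lemma bernoulli0 : bernoulli 0 = 1.
Proof. by []. Qed.

Lemma bernoulli_rec n : (1 <= n)%N ->
  \sum_(i < n.+1) 'C(n.+1, i)%:R * bernoulli i = 0.
Proof.
case: n => // n _; rewrite big_ord_recr /=.
have -> : bernoulli n.+1 = - (n.+2%:R)^-1 *
    \sum_(i < n.+1) 'C(n.+2, i)%:R * bernoulli i.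
  have bsS : bernoulli_seq n.+2 = rcons (bernoulli_seq n.+1)
      (- (n.+2%:R)^-1 *
         \sum_(i < n.+1) 'C(n.+2, i)%:R * (bernoulli_seq n.+1)`_i) by [].
  rewrite {1}/bernoulli bsS nth_rcons size_bernoulli_seq ltnn eqxx.
  by congr (_ * _); apply: eq_bigr => i _; rewrite nth_bernoulli_seq.
by rewrite binSn mulrA mulrN mulfV ?pnatr_eq0 // mulN1r subrr.
Qed.

(* Main.v *)
From HB Require Import structures.
Require Import Defs.
From mathcomp Require Import lra ring zify.

Set Implicit Arguments.
Unset Strict Implicit.
Unset Printing Implicit Defensive.

Import Order.TTheory GRing.Theory Num.Theory.
Local Open Scope ring_scope.

(* Put q = p^r and work in Z/q, writing h(x) = 1/x for units and h(x) = 0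
   otherwise. The sum over i + j + k = 2q is the sum over i <= 2q of
   (-1)^i h(i) C(2q - i), where C(n) is the sum of h(j) h(n - j) over j <= n,
   and C(q + n) = K(n) + C(n) with K the cyclic convolution h * h on Z/q. As q
   is odd, the halves i < q and i >= q combine to the sum over i < q of
   (-1)^i h(i) K(-i). Scaling gives K(x) = K(1)/x^2 for a unit x, and partial
   fractions give K(1) = -2 p^(r-1). What remains is
   -2 p^(r-1) sum_(i < q) (-1)^i i^(-3), where the last factor matters only
   mod p and i^(-3) may be replaced by i^(p-4) (by i when p = 3).

   The alternating power sums sum_(a < q) (-1)^a a^n satisfy in Z/q the
   recurrence defining the values E_n(0) = 2 (1 - 2^(n+1)) B_(n+1) / (n+1) of
   the Euler polynomials, hence are their reductions mod q; n = p - 4 yields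
   B_(p-3), and E_1(0) = -1/2 settles p = 3. *)

Lemma shift_invariant_scalar_eq0 (R : numDomainType) (L : {scalar {poly R}}) :
  (forall f, L (f \Po (1 + 'X)) = L f) -> forall f, L f = 0.
Proof.
move=> shiftL; have LXn n : L 'X^n = 0.
  elim/ltn_ind: n => n IHn; have := shiftL 'X^(n.+1).
  rewrite rmorphXn /= comp_polyX exprDn linear_sum.
  rewrite !big_ord_recr big1 /= => [|i _]; last first.
    by rewrite expr1n mul1r linearMn /= IHn ?mul0rn.
  rewrite !expr1n !mul1r binn binSn linearMn /= add0r => /(canRL (addrK _)).
  by rewrite subrr => /eqP; rewrite mulrn_eq0 => /eqP.
move=> f; rewrite -[f]coefK poly_def linear_sum big1 // => i _.
by rewrite linearZ /= LXn mulr0.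
Qed.

Definition umbral (f : {poly rat}) : rat :=
  \sum_(i < size f) f`_i * bernoulli i.

Lemma umbral_widen (n : nat) (f : {poly rat}) : (size f <= n)%N ->
  umbral f = \sum_(i < n) f`_i * bernoulli i.
Proof.
move=> le_fn; rewrite /umbral.
rewrite (big_ord_widen n (fun i => f`_i * bernoulli i)) //.
rewrite big_mkcond /=; apply: eq_bigr => i _.
by case: ltnP => // le_fi; rewrite nth_default ?mul0r.
Qed.

Lemma umbral_is_scalar : scalar umbral.
Proof.
move=> a f g; pose n := maxn (size (a *: f + g)) (maxn (size f) (size g)).
rewrite (@umbral_widen n (a *: f + g)) ?leq_maxl //.
rewrite (@umbral_widen n f) ?(@umbral_widen n g); try by rewrite /n; lia.
rewrite mulr_sumr -big_split; apply: eq_bigr => i _ /=.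
by rewrite coefD coefZ mulrDl mulrA.
Qed.

HB.instance Definition _ :=
  GRing.isLinear.Build rat {poly rat} rat *%R umbral umbral_is_scalar.

Lemma umbralXn (n : nat) : umbral 'X^n = bernoulli n.
Proof.
rewrite /umbral size_polyXn big_ord_recr /= coefXn eqxx mul1r big1 ?add0r //.
by move=> i _; rewrite coefXn ltn_eqF ?mul0r.
Qed.

Lemma umbral_add1ZXn (c : rat) (n : nat) :
  umbral ((1 + c *: 'X) ^+ n) =
  \sum_(i < n.+1) 'C(n, i)%:R * (c ^+ i * bernoulli i).
Proof.
rewrite exprDn linear_sum; apply: eq_bigr => i _ /=.
by rewrite expr1n mul1r exprZn linearMn linearZ /= umbralXn mulr_natl.
Qed.

Lemma umbral_add1Xn (n : nat) :
  umbral ((1 + 'X) ^+ n) = bernoulli n + (n == 1)%:R.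
Proof.
rewrite -['X]scale1r umbral_add1ZXn.
case: n => [|[|n]]; first by rewrite big_ord1.
  by rewrite !big_ord_recr big_ord0 /= bernoulli0 bin0 binn; ring.
rewrite big_ord_recr /= binn expr1n !mul1r addr0 addrC.
under eq_bigr do rewrite expr1n mul1r.
by rewrite bernoulli_rec // addr0.
Qed.

Lemma umbral_shift (f : {poly rat}) :
  umbral (f \Po (1 + 'X)) = umbral f + f^`().[0].
Proof.
rewrite -[f]coefK poly_def !linear_sum /= horner_sum -big_split.
apply: eq_bigr => i _ /=; rewrite !linearZ /= hornerZ -mulrDr; congr (_ * _).
rewrite rmorphXn /= comp_polyX umbral_add1Xn umbralXn derivXn hornerMn hornerXn.
by case: (nat_of_ord i) => [|[|n]]; rewrite ?expr0n ?mul0rn ?mulr1n.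
Qed.

(* Raabe's multiplication formula: as a functional of [f], the difference of the
   two sides is invariant under the shift by [1]. *)
Lemma umbral_multiplication (m : nat) (f : {poly rat}) :
  \sum_(k < m) umbral (f \Po (k%:R%:P + m%:R *: 'X)) = m%:R * umbral f.
Proof.
pose g k h := h \Po (k%:R%:P + m%:R *: 'X) : {poly rat}.
pose D h := \sum_(k < m) umbral (g k h) - m%:R * umbral h.
have scalarD : scalar D.
  move=> a u v; rewrite /D /g; under eq_bigr do rewrite !linearP /=.
  by rewrite big_split /= -mulr_sumr linearP /=; ring.
pose DL : {scalar {poly rat}} := HB.pack D
  (GRing.isLinear.Build rat {poly rat} rat *%R D scalarD).
suff D0 : forall h, DL h = 0 by apply/eqP; rewrite -subr_eq0; exact/eqP/(D0 f).
apply: shift_invariant_scalar_eq0 => {}f; rewrite /= /D.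
have g_shift k : g k (f \Po (1 + 'X)) = g k.+1 f.
  rewrite /g -comp_polyA comp_polyD comp_polyC comp_polyX.
  by rewrite -nat1r polyCD addrA.
have gm : g m f = g 0 f \Po (1 + 'X).
  rewrite /g -comp_polyA comp_polyD comp_polyZ comp_polyX comp_polyC.
  by rewrite scalerDr alg_polyC add0r.
have : \sum_(k < m) (umbral (g k.+1 f) - umbral (g k f)) = m%:R * f^`().[0].
  rewrite -(big_mkord xpredT (fun k => umbral (g k.+1 f) - umbral (g k f))).
  rewrite telescope_sumr // gm umbral_shift [LHS]addrC addKr deriv_comp add0r.
  by rewrite derivZ derivX hornerM horner_comp !hornerE /= mulr1 mulrC.
rewrite sumrB => /(canRL (subrK _)) telescope.
by under eq_bigr do rewrite g_shift; rewrite telescope umbral_shift; ring.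
Qed.

Definition genocchi (n : nat) : rat := (2 - 2 ^+ n.+1) * bernoulli n.

Lemma genocchi_rec (n : nat) :
  genocchi n + \sum_(i < n.+1) 'C(n, i)%:R * genocchi i = 2 * (n == 1)%:R.
Proof.
have -> : \sum_(i < n.+1) 'C(n, i)%:R * genocchi i =
    2 * (umbral ((1 + 'X) ^+ n) - umbral ((1 + 2 *: 'X) ^+ n)).
  rewrite -{1}['X]scale1r !umbral_add1ZXn -sumrB mulr_sumr.
  by apply: eq_bigr => i _; rewrite /genocchi expr1n exprS; ring.
have := umbral_multiplication 2 'X^n; have := umbral_shift 'X^n.
rewrite !big_ord_recr big_ord0 /= !rmorphXn /= !comp_polyX add0r.
rewrite add0r exprZn linearZ /= umbralXn derivXn hornerMn hornerXn.
rewrite polyC1 /genocchi exprS => -> /(canRL (addKr _)) ->.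
by case: n => [|[|n]]; rewrite ?expr0n /= ?mul0rn; ring.
Qed.

(* The values E_n(0) of the Euler polynomials are the solution in [rat]. *)
Definition euler_rec (R : pzRingType) (e : nat -> R) : Prop :=
  forall n, e n + \sum_(i < n.+1) 'C(n, i)%:R * e i = 2 * (n == 0)%:R.

Lemma euler_recE (R : comUnitRingType) (e : nat -> R) (n : nat) :
  2 \is a @GRing.unit R -> euler_rec e ->
  e n = (2 * (n == 0)%:R - \sum_(i < n) 'C(n, i)%:R * e i) * 2^-1.
Proof.
move=> u2 eE; apply: (mulIr u2); rewrite mulrVK // -eE.
by rewrite big_ord_recr /= binn; ring.
Qed.

Definition euler0 (n : nat) : rat := genocchi n.+1 / n.+1%:R.

Lemma euler0_rec : euler_rec euler0.
Proof.
move=> n; have n1_neq0 k : k.+1%:R != 0 :> rat by rewrite pnatr_eq0.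
have euler0E k : k.+1%:R * euler0 k = genocchi k.+1 by rewrite mulrC divfK.
apply: (mulfI (n1_neq0 n)); rewrite mulrDr mulr_sumr euler0E.
have := genocchi_rec n.+1; rewrite big_ord_recl /= eqSS.
rewrite {2}/genocchi subrr mul0r mulr0 add0r.
have -> : \sum_(i < n.+1) 'C(n.+1, bump 0 i)%:R * genocchi (bump 0 i) =
    \sum_(i < n.+1) n.+1%:R * ('C(n, i)%:R * euler0 i).
  apply: eq_bigr => i _; rewrite /bump add1n -euler0E !mulrA -!natrM.
  by rewrite mul_bin_diag [(i.+1 * _)%N]mulnC.
by move->; case: n => [|n]; rewrite ?mulr0 ?mul1r.
Qed.

Definition alt_power_sum (R : pzRingType) (q n : nat) : R :=
  \sum_(a < q) (-1) ^+ a * a%:R ^+ n.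

Lemma alt_power_sum_rec (R : comPzRingType) (q : nat) :
  q%:R = 0 :> R -> odd q -> euler_rec (alt_power_sum R q).
Proof.
move=> q0 q_odd n; rewrite /alt_power_sum.
under [X in _ + X]eq_bigr do rewrite mulr_sumr.
rewrite exchange_big -big_split /=.
rewrite -(big_mkord xpredT (fun a => (-1) ^+ a * a%:R ^+ n +
  \sum_(i < n.+1) 'C(n, i)%:R * ((-1) ^+ a * a%:R ^+ i) : R)).
rewrite (telescope_sumr_eq (fun a => - ((-1) ^+ a * a%:R ^+ n))) // => [|a _].
  rewrite -signr_odd q_odd q0 expr0n expr0 expr1 mul1r mulN1r !opprK.
  by rewrite mulr_natl mulr2n.
rewrite exprS mulN1r mulNr !opprK [RHS]addrC -[in RHS]nat1r exprDn mulr_sumr.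
by congr (_ + _); apply: eq_bigr => i _; rewrite expr1n mul1r mulrCA mulr_natl.
Qed.

(* The graph of the reduction map to [R], defined on the rationals with an
   invertible denominator: being a relation, it carries the integrality of [x]
   along with the value. *)
Definition reduces (R : comUnitRingType) (x : rat) (v : R) : Prop :=
  exists n d : int,
    [/\ d%:~R \is a @GRing.unit R, x * d%:~R = n%:~R & v * d%:~R = n%:~R].

Section Reduction.

Variable R : comUnitRingType.
Implicit Types (x y : rat) (v w : R).

Lemma reduces_nat (n : nat) : reduces n%:R (n%:R : R).
Proof. by exists n, 1; rewrite !mulr1 unitr1. Qed.

Lemma reducesD x y v w : reduces x v -> reduces y w -> reduces (x + y) (v + w).
Proof.
move=> [n [d [ud xE vE]]] [m [e [ue yE wE]]]; exists (n * e + m * d), (d * e).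
rewrite rmorphM unitrM ud ue !rmorphD !rmorphM /= -xE -yE -vE -wE.
by split=> //; ring.
Qed.

Lemma reducesM x y v w : reduces x v -> reduces y w -> reduces (x * y) (v * w).
Proof.
move=> [n [d [ud xE vE]]] [m [e [ue yE wE]]]; exists (n * m), (d * e).
rewrite rmorphM unitrM ud ue !rmorphM /= -xE -yE -vE -wE.
by split=> //; ring.
Qed.

Lemma reducesN x v : reduces x v -> reduces (- x) (- v).
Proof.
move=> [n [d [ud xE vE]]]; exists (- n), d.
by rewrite !rmorphN /= -xE -vE !mulNr.
Qed.

Lemma reducesX x v (n : nat) : reduces x v -> reduces (x ^+ n) (v ^+ n).
Proof.
move=> xv; elim: n => [|n IHn]; first exact: (reduces_nat 1).
by rewrite !exprS; apply: reducesM.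
Qed.

Lemma reduces_unit_neq0 x v : v \is a GRing.unit -> reduces x v -> x != 0.
Proof.
move=> uv [n [d [ud xE vE]]]; have : n%:~R \is a @GRing.unit R.
  by rewrite -vE unitrM uv.
apply: contraTneq => x0; move/eqP: xE; rewrite x0 mul0r eq_sym intr_eq0.
by move=> /eqP->; rewrite unitr0.
Qed.

Lemma reducesV x v : v \is a GRing.unit -> reduces x v -> reduces x^-1 v^-1.
Proof.
move=> uv xv; have x_neq0 := reduces_unit_neq0 uv xv.
have [n [d [ud xE vE]]] := xv; exists d, n; rewrite -{1}vE unitrM uv ud.
by split; rewrite // -?xE -?vE ?mulKf ?mulKr.
Qed.

Lemma reduces_sum (I : Type) (s : seq I) (P : pred I)
    (F : I -> rat) (G : I -> R) :
  (forall i, P i -> reduces (F i) (G i)) ->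
  reduces (\sum_(i <- s | P i) F i) (\sum_(i <- s | P i) G i).
Proof.
move=> FG; apply: (big_ind2 (@reduces R)) => //; first exact: (reduces_nat 0).
by move=> x v y w; apply: reducesD.
Qed.

Lemma reduces_euler_rec (x : nat -> rat) (v : nat -> R) :
  2 \is a @GRing.unit R -> euler_rec x -> euler_rec v ->
  forall n, reduces (x n) (v n).
Proof.
move=> u2 xE vE; elim/ltn_ind=> n IHn.
rewrite (euler_recE _ _ xE) // (euler_recE _ u2 vE).
apply: reducesM; last by apply: reducesV => //; apply: (reduces_nat 2).
apply: reducesD.
  by apply: reducesM; [apply: (reduces_nat 2) | apply: reduces_nat].
apply/reducesN/reduces_sum => i _.
by apply: reducesM; [apply: reduces_nat | apply: IHn].
Qed.

End Reduction.

Lemma dvdz_denq (x : rat) (n d : int) :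
  d != 0 -> x * d%:~R = n%:~R -> (denq x %| d)%Z.
Proof.
move=> d_neq0 xE; have -> : x = fracq (n, d).
  by rewrite fracqE /= -xE mulfK ?intr_eq0.
have [_ dE] := @valq_frac (n, d) d_neq0.
by rewrite [X in (_ %| X)%Z]dE dvdz_mull.
Qed.

Lemma intr_Zp_eq0 (q : nat) (n : int) : (1 < q)%N ->
  (n%:~R == 0 :> 'Z_q) = (q%:Z %| n)%Z.
Proof.
move=> q_gt1.
have natE (k : nat) : (k%:R == 0 :> 'Z_q) = (q %| k)%N.
  by rewrite -(inj_eq val_inj) /= val_Zp_nat.
by case: n => k; rewrite dvdzE ?NegzE ?rmorphN ?oppr_eq0 /= -pmulrn natE.
Qed.

Lemma intr_Zp_unit (q : nat) (n : int) : (1 < q)%N ->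
  ((n%:~R : 'Z_q) \is a GRing.unit) = coprime q `|n|.
Proof.
move=> q_gt1.
by case: n => k; rewrite ?NegzE ?rmorphN ?unitrN /= -pmulrn unitZpE.
Qed.

Lemma reduces0_p_integral (q : nat) (x : rat) :
  (1 < q)%N -> reduces x (0 : 'Z_q) -> p_integral q (x / q%:R).
Proof.
move=> q_gt1 [n [d [ud xE]]]; rewrite mul0r => /esym/eqP.
rewrite intr_Zp_eq0 // => /dvdzP[m nE].
have d_neq0 : d != 0 by apply: contraTneq ud => ->; rewrite unitr0.
have q_neq0 : q%:R != 0 :> rat by rewrite pnatr_eq0 -lt0n ltnW.
rewrite intr_Zp_unit // coprime_sym in ud; apply: coprime_dvdl ud.
apply: (dvdz_denq (n := m)) d_neq0 _.
by apply: (mulIf q_neq0); rewrite mulrAC divfK // xE nE rmorphM.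
Qed.

Lemma reduces_eqmodp (p r : nat) (x y : rat) (v : 'Z_(p ^ r)) :
  (1 < p ^ r)%N -> (0 < r)%N -> reduces x v -> reduces y v -> eqmodp p r x y.
Proof.
move=> q_gt1 r_gt0 xv yv; rewrite /eqmodp /p_integral -(@coprime_pexpr r) //.
apply: reduces0_p_integral => //; rewrite -(subrr v).
by apply/reducesD/reducesN.
Qed.

Definition cauchy_product (R : pzRingType) (f g : nat -> R) (n : nat) : R :=
  \sum_(j < n.+1) f j * g (n - j)%N.

Definition cyclic_conv (V : finZmodType) (R : pzRingType) (f g : V -> R)
    (x : V) : R :=
  \sum_y f y * g (x - y).

Lemma triple_sum_cauchy_product (R : pzRingType) (f g h : nat -> R) (n : nat) :
  \sum_(i < n.+1) \sum_(j < n.+1) \sum_(k < n.+1 | (i + j + k == n)%N)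
     f i * g j * h k =
  \sum_(i < n.+1) f i * cauchy_product g h (n - i).
Proof.
apply: eq_bigr => i _; rewrite /cauchy_product mulr_sumr.
have le_in : (i <= n)%N by rewrite -ltnS.
have le_ni : ((n - i).+1 <= n.+1)%N by lia.
rewrite (big_ord_widen _ (fun j => f i * (g j * h (n - i - j)%N)) le_ni).
rewrite [RHS]big_mkcond; apply: eq_bigr => j _.
case: ifP => lt_j; last first.
  by rewrite big_pred0 // => k; apply/negP => /eqP ijk; lia.
have lt_k : (n - i - j < n.+1)%N by lia.
rewrite (big_pred1 (Ordinal lt_k)) /= ?mulrA // => k /=.
by rewrite -(inj_eq val_inj) /=; lia.
Qed.

Lemma sum_natr_Zp (V : nmodType) (q : nat) (F : 'Z_q -> V) : (1 < q)%N ->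
  \sum_(i < q) F i%:R = \sum_x F x.
Proof.
move=> q_gt1; rewrite -(big_mkord xpredT (fun i => F i%:R)).
rewrite -[X in index_iota _ X](Zp_cast q_gt1) big_mkord.
by apply: eq_bigr => i _; rewrite natr_Zp.
Qed.

Section CyclicConvolution.

Variables (q : nat) (R : pzRingType).
Hypothesis q_gt1 : (1 < q)%N.
Implicit Types f g h : 'Z_q -> R.

Lemma natr_addq (n : nat) : (q + n)%:R = n%:R :> 'Z_q.
Proof. by rewrite natrD pchar_Zp ?add0r. Qed.

Lemma cauchy_product_addq f g (n : nat)
    (f' := fun j => f j%:R) (g' := fun j => g j%:R) :
  cauchy_product f' g' (q + n) = cyclic_conv f g n%:R + cauchy_product f' g' n.
Proof.
rewrite /cauchy_product -addnS big_split_ord /=; congr (_ + _).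
  rewrite /cyclic_conv -sum_natr_Zp //; apply: eq_bigr => i _.
  by rewrite /g' natrB ?natr_addq //; have := ltn_ord i; lia.
by apply: eq_bigr => i _; rewrite /f' natr_addq subnDl.
Qed.

(* As [q] is odd, shifting [i] by [q] flips the sign, so that only the cyclic
   part of the Cauchy products survives. *)
Lemma alt_sum_cauchy_product f g h (f' := fun j => f j%:R)
    (g' := fun j => g j%:R) (h' := fun j => h j%:R) : odd q ->
  \sum_(i < (2 * q).+1) (-1) ^+ i * f' i * cauchy_product g' h' (2 * q - i) =
  \sum_(i < q) (-1) ^+ i * f' i * cyclic_conv g h (- i%:R) + f 0 * (g 0 * h 0).
Proof.
move=> q_odd; have -> : (2 * q).+1 = (q + q.+1)%N by lia.
rewrite big_split_ord big_ord_recr /= addrA -big_split /=; congr (_ + _).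
  apply: eq_bigr => i _; have lt_iq := ltn_ord i.
  have -> : (2 * q - i = q + (q - i))%N by lia.
  have -> : (2 * q - (q + i) = q - i)%N by lia.
  rewrite cauchy_product_addq natrB ?(ltnW lt_iq) // pchar_Zp // sub0r mulrDr.
  rewrite exprD -[(-1) ^+ q]signr_odd q_odd expr1 /f' natr_addq mulN1r.
  by rewrite !mulNr addrK.
rewrite addnn mul2n subnn /f' -addnn natr_addq pchar_Zp // -signr_odd addnn.
by rewrite odd_double mul1r /cauchy_product big_ord1.
Qed.

End CyclicConvolution.

Lemma cyclic_conv_unit (R : finUnitRingType) (S : comPzRingType)
    (f g : R -> S) (x : R) :
  {morph f : y z / y * z} -> {morph g : y z / y * z} -> x \is a GRing.unit ->
  cyclic_conv f g x = f x * g x * cyclic_conv f g 1.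
Proof.
move=> fM gM ux; rewrite /cyclic_conv (reindex_inj (mulrI ux)) mulr_sumr.
by apply: eq_bigr => y _; rewrite -{2}[x]mulr1 -mulrBr fM gM mulrACA.
Qed.

(* MathComp sets [x^-1 = x] for nonunits; here they are sent to [0]. *)
Definition inv0 (R : unitRingType) (x : R) : R :=
  if x \is a GRing.unit then x^-1 else 0.

Lemma inv0M (R : comUnitRingType) : {morph @inv0 R : x y / x * y}.
Proof.
move=> x y; rewrite /inv0 unitrM.
case: ifPn => [/andP[ux uy]|]; first by rewrite ux uy invrM // mulrC.
by rewrite negb_and => /orP[] /negbTE->; rewrite ?mul0r ?mulr0.
Qed.

Lemma inv0N (R : unitRingType) : {morph @inv0 R : x / - x}.
Proof. by move=> x; rewrite /inv0 unitrN invrN; case: ifP; rewrite ?oppr0. Qed.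

Lemma inv00 (R : unitRingType) : inv0 0 = 0 :> R.
Proof. by rewrite /inv0 unitr0. Qed.

Definition local_ring (R : unitRingType) : Prop :=
  forall x : R, (x \is a GRing.unit) || (1 - x \is a GRing.unit).

Section Inv0Convolution.

Variable R : finComUnitRingType.
Hypothesis unit2 : 2 \is a @GRing.unit R.

Lemma sum_odd_eq0 (P : pred R) (F : R -> R) :
  (forall x, P (- x) = P x) -> {morph F : x / - x} -> \sum_(x | P x) F x = 0.
Proof.
move=> PN FN; apply: (mulrI unit2); rewrite mulr0 mulr_natl mulr2n.
rewrite {1}(reindex_inj oppr_inj) (eq_bigl _ _ PN) -big_split big1 //= => x _.
by rewrite FN addNr.
Qed.

Hypothesis localR : local_ring R.

Let subK : involutive (fun x : R => 1 - x) := fun x => subKr 1 x.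

Let U : pred R := [pred x | (x \is a GRing.unit) && (1 - x \is a GRing.unit)].

Lemma sum_unit_sub1_unit :
  \sum_(x | U x) x^-1 = - #|[pred x : R | x \isn't a GRing.unit]|%:R.
Proof.
transitivity (\sum_(x | U x) x).
  rewrite (reindex_inj invr_inj); apply: eq_big => [x|x _]; last exact: invrK.
  rewrite /U /= unitrV; case ux: (x \is a GRing.unit) => //=.
  have -> : 1 - x^-1 = - (x^-1 * (1 - x)).
    by rewrite mulrBr mulr1 mulVr // opprB.
  by rewrite unitrN unitrMr ?unitrV.
have sum_unit : \sum_(x : R | x \is a GRing.unit) x = 0.
  by apply: sum_odd_eq0 => // x; rewrite unitrN.
rewrite /U /=.
rewrite (bigID (fun x => 1 - x \is a GRing.unit)) /= in sum_unit.
move/eqP: sum_unit; rewrite addr_eq0 => /eqP->; congr (- _).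
rewrite (reindex_inj (inv_inj subK)) /=.
rewrite (eq_bigl [pred x : R | x \isn't a GRing.unit]) => [|x] /=; last first.
  by rewrite subKr andbC; have := localR x; case: (x \is a GRing.unit) => /=.
rewrite sumrB [X in _ - X]sum_odd_eq0 ?subr0 ?sumr_const // => x.
by rewrite /= unitrN.
Qed.

(* Partial fractions: [1 / (x (1 - x)) = 1 / x + 1 / (1 - x)]. *)
Lemma inv0_cyclic_conv1 :
  cyclic_conv (@inv0 R) (@inv0 R) 1 =
  - 2 * #|[pred x : R | x \isn't a GRing.unit]|%:R.
Proof.
have -> : cyclic_conv (@inv0 R) (@inv0 R) 1 =
    \sum_(x | U x) (x^-1 + (1 - x)^-1).
  rewrite [RHS]big_mkcond; apply: eq_bigr => x _; rewrite /U /= /inv0.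
  case: ifP => ux; last by rewrite mul0r.
  case: ifP => ux1; last by rewrite mulr0.
  apply: (mulrI ux); apply: (mulIr ux1).
  rewrite mulVKr // mulVr // [x * _]mulrDr divrr // mulrDl mul1r divrK //.
  by rewrite subrK.
rewrite big_split /= [X in _ + X](reindex_inj (inv_inj subK)) /=.
rewrite [X in _ + X](eq_big U (fun x => x^-1)) => [|x|x _]; last first.
- by rewrite subKr.
- by rewrite /U /= subKr andbC.
by rewrite sum_unit_sub1_unit -mulr2n mulNr mulr_natl mulNrn.
Qed.

End Inv0Convolution.

Lemma alt_sum_inv0_cauchy_product (q : nat) (f := fun i => inv0 (i%:R : 'Z_q)) :
  (1 < q)%N -> odd q ->
  \sum_(i < (2 * q).+1) (-1) ^+ i * f i * cauchy_product f f (2 * q - i) =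
  cyclic_conv (@inv0 'Z_q) (@inv0 'Z_q) 1 * \sum_(i < q) (-1) ^+ i * f i ^+ 3.
Proof.
move=> q_gt1 q_odd; rewrite (@alt_sum_cauchy_product q) // inv00 mul0r addr0.
rewrite mulr_sumr; apply: eq_bigr => i _; rewrite /f.
have [ui|nui] := boolP ((i%:R : 'Z_q) \is a GRing.unit); last first.
  by rewrite /inv0 (negbTE nui) expr0n !mulr0 mul0r.
rewrite cyclic_conv_unit ?unitrN //; [|exact: inv0M|exact: inv0M].
by rewrite inv0N; ring.
Qed.

Lemma unitr_sub1_nilpotent (R : comUnitRingType) (x : R) (n : nat) :
  x ^+ n = 0 -> 1 - x \is a GRing.unit.
Proof.
move=> xn0; apply/unitrP; exists (\sum_(i < n) x ^+ i).
suff xK : (1 - x) * \sum_(i < n) x ^+ i = 1 by rewrite mulrC xK.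
by rewrite -opprB mulNr -subrX1 xn0 sub0r opprK.
Qed.

Section PrimePowerModulus.

Variables p r : nat.
Hypotheses (p_prime : prime p) (r_gt0 : (0 < r)%N).

Local Notation Zq := 'Z_(p ^ r).

Lemma pfactor_gt1 : (1 < p ^ r)%N.
Proof. by rewrite -(exp1n r) ltn_exp2r ?prime_gt1. Qed.

Lemma unitr_natZpX (a : nat) : (a%:R \is a @GRing.unit Zq) = ~~ (p %| a)%N.
Proof. by rewrite unitZpE ?pfactor_gt1 // coprime_pexpl // prime_coprime. Qed.

Lemma local_ring_ZpX : local_ring Zq.
Proof.
move=> x; rewrite -(natr_Zp x) unitr_natZpX.
case: (boolP (p %| x)%N) => //= p_dvd_x.
have [m ->] := dvdnP p_dvd_x; apply: (@unitr_sub1_nilpotent _ _ r).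
by rewrite -natrX expnMn natrM pchar_Zp ?pfactor_gt1 // mulr0.
Qed.

Lemma card_nonunit_ZpX :
  #|[pred x : Zq | x \isn't a GRing.unit]| = (p ^ r.-1)%N.
Proof.
have cardZq : #|{: Zq}| = (p ^ r)%N by rewrite card_ord Zp_cast ?pfactor_gt1.
have := cardC [pred x : Zq | x \is a GRing.unit]; rewrite cardZq.
have := card_units_Zp (ltnW pfactor_gt1); rewrite cardsT card_sub => ->.
have qE : (p ^ r = p.-1 * p ^ r.-1 + p ^ r.-1)%N.
  by rewrite -mulSnr prednK ?prime_gt0 // -expnS prednK.
by rewrite totient_pfactor // [RHS]qE => /addnI <-; apply: eq_card.
Qed.

(* The generator of the annihilator of the maximal ideal: multiplying by it only
   sees residues mod p. *)
Definition socle_gen : Zq := (p ^ r.-1)%:R.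

Lemma socle_gen_eqmod (a b : nat) : a = b %[mod p] ->
  socle_gen * a%:R = socle_gen * b%:R.
Proof.
suff modE c : socle_gen * (c %% p)%N%:R = socle_gen * c%:R.
  by move=> ab; rewrite -modE ab modE.
rewrite {2}(divn_eq c p) natrD mulrDr -[_ * (_ * _)%:R]natrM mulnCA -expnSr.
by rewrite prednK // natrM pchar_Zp ?pfactor_gt1 // mulr0 add0r.
Qed.

Lemma socle_gen_nonunit (x : Zq) : x \isn't a GRing.unit -> socle_gen * x = 0.
Proof.
rewrite -(natr_Zp x) unitr_natZpX negbK => /eqP p_dvd_x.
by rewrite (@socle_gen_eqmod _ 0) ?mulr0 // mod0n.
Qed.

Lemma socle_gen_fermat (x : Zq) : socle_gen * x ^+ p = socle_gen * x.
Proof. by rewrite -(natr_Zp x) -natrX; apply/socle_gen_eqmod/fermat_little. Qed.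

Lemma socle_gen_unit_fermat (x : Zq) (k : nat) : x \is a GRing.unit ->
  (p.-1 %| k)%N -> socle_gen * x ^+ k = socle_gen.
Proof.
move=> ux /dvdnP[m ->]; rewrite mulnC.
elim: m => [|m IHm]; first by rewrite muln0 mulr1.
rewrite mulnS exprD mulrA; suff -> : socle_gen * x ^+ p.-1 = socle_gen by [].
apply: (mulIr ux); rewrite -mulrA -exprSr prednK ?prime_gt0 //.
exact: socle_gen_fermat.
Qed.

Lemma socle_gen_inv0X (x : Zq) (n m : nat) : (0 < n)%N -> (0 < m)%N ->
  (p.-1 %| m + n)%N -> socle_gen * inv0 x ^+ n = socle_gen * x ^+ m.
Proof.
move=> n_gt0 m_gt0 mn; rewrite /inv0; case: ifPn => ux.
  apply: (mulIr (unitrX n ux)); rewrite exprVn divrK ?unitrX // -mulrA -exprD.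
  by rewrite socle_gen_unit_fermat.
rewrite expr0n gtn_eqF // mulr0 -(prednK m_gt0) exprS mulrA.
by rewrite socle_gen_nonunit ?mul0r.
Qed.

Lemma socle_gen_alt_sum_inv0X (n m : nat) : (0 < n)%N -> (0 < m)%N ->
  (p.-1 %| m + n)%N ->
  socle_gen * \sum_(i < p ^ r) (-1) ^+ i * inv0 (i%:R : Zq) ^+ n =
  socle_gen * alt_power_sum Zq (p ^ r) m.
Proof.
move=> n_gt0 m_gt0 mn; rewrite !mulr_sumr; apply: eq_bigr => i _.
by rewrite mulrCA (@socle_gen_inv0X _ n m) // mulrCA.
Qed.

Hypothesis p_odd : odd p.

Lemma odd_pfactor : odd (p ^ r).
Proof. by rewrite oddX p_odd orbT. Qed.

Lemma unit2_ZpX : 2 \is a @GRing.unit Zq.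
Proof. by rewrite (unitr_natZpX 2) -prime_coprime // coprimen2. Qed.

Lemma inv0_cyclic_conv1_ZpX :
  cyclic_conv (@inv0 Zq) (@inv0 Zq) 1 = - 2 * socle_gen.
Proof.
rewrite inv0_cyclic_conv1 ?card_nonunit_ZpX //; first exact: unit2_ZpX.
exact: local_ring_ZpX.
Qed.

Lemma reduces_euler0 (n : nat) :
  reduces (euler0 n) (alt_power_sum Zq (p ^ r) n).
Proof.
apply: (reduces_euler_rec unit2_ZpX euler0_rec).
by apply: alt_power_sum_rec odd_pfactor; rewrite pchar_Zp ?pfactor_gt1.
Qed.

Lemma unit_two_sub_exp2 : (3 < p)%N -> 2 - 2 ^+ (p - 2) \is a @GRing.unit Zq.
Proof.
move=> p_gt3; have le2 : (2 <= 2 ^ (p - 2))%N.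
  by rewrite (@leq_exp2l 2 1) //; lia.
rewrite -unitrN opprB -natrX -natrB // unitr_natZpX -eqn_mod_dvd //.
apply/negP => /eqP fermat2; have := fermat_little 2 p_prime.
have -> : (2 ^ p = 2 ^ 2 * 2 ^ (p - 2))%N.
  by rewrite -expnD subnKC // ltnW // ltnW.
rewrite -modnMmr fermat2 modnMmr => /eqP; rewrite eqn_mod_dvd //.
by rewrite (@Euclid_dvdM 2 3) //; apply/negP; rewrite negb_or !gtnNdvd // ltnW.
Qed.

Lemma socle_gen_sub3 : (2 < p)%N -> socle_gen * (p - 3)%N%:R = - 3 * socle_gen.
Proof.
move=> p_gt2; rewrite natrB // mulrBr (@socle_gen_eqmod p 0) ?modnn ?mod0n //.
ring.
Qed.

Lemma socle_gen_two_sub_exp2 : (2 < p)%N ->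
  - 2 * socle_gen * (2 - 2 ^+ (p - 2)) = - 3 * socle_gen.
Proof.
move=> p_gt2; transitivity (socle_gen * 2 ^+ p.-1 - 4 * socle_gen).
  by rewrite (_ : p.-1 = (p - 2).+1) ?exprS; [ring | lia].
by rewrite socle_gen_unit_fermat ?unit2_ZpX //; ring.
Qed.

Lemma reduces_bernoulli_alt_power_sum_eq3 : p = 3 ->
  reduces ((p ^ r.-1)%N%:R * bernoulli (p - 3))
    (- 2 * socle_gen * alt_power_sum Zq (p ^ r) 1).
Proof.
move=> p3; have -> : bernoulli (p - 3) = - 2 * euler0 1.
  have := euler0_rec 1; have := euler0_rec 0; rewrite p3 bernoulli0.
  rewrite !big_ord_recr !big_ord0 /= !bin0 bin1.
  by move: (euler0 0) (euler0 1) => e0 e1; lra.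
rewrite mulrCA mulrA; apply: reducesM (reduces_euler0 1).
by apply: reducesM; [apply/reducesN/(reduces_nat _ 2) | apply: reduces_nat].
Qed.

Lemma reduces_bernoulli_alt_power_sum_gt3 : (3 < p)%N ->
  reduces ((p ^ r.-1)%N%:R * bernoulli (p - 3))
    (- 2 * socle_gen * alt_power_sum Zq (p ^ r) (p - 4)).
Proof.
move=> p_gt3; have u2 := unit_two_sub_exp2 p_gt3.
have u2_reduces : reduces (2 - 2 ^+ (p - 2)) (2 - 2 ^+ (p - 2) : Zq).
  by apply/reducesD/reducesN/reducesX; exact: (reduces_nat _ 2).
set e := alt_power_sum _ _ _.
have p3E : (p - 4).+1 = (p - 3)%N by lia.
have p2E : (p - 4).+2 = (p - 2)%N by lia.
have -> : bernoulli (p - 3) =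
    euler0 (p - 4) * (p - 3)%N%:R / (2 - 2 ^+ (p - 2)).
  rewrite /euler0 /genocchi p2E p3E divfK ?pnatr_eq0 ?subn_eq0 -?ltnNge //.
  by rewrite mulrC mulKf ?(reduces_unit_neq0 u2 u2_reduces).
have -> : - 2 * socle_gen * e =
    socle_gen * (e * (p - 3)%N%:R / (2 - 2 ^+ (p - 2))).
  apply: (mulIr u2); rewrite mulrA divrK // mulrAC.
  rewrite socle_gen_two_sub_exp2 1?ltnW //.
  by rewrite mulrCA socle_gen_sub3 1?ltnW // mulrC.
apply: reducesM; first exact: reduces_nat.
apply: reducesM; last exact: reducesV.
by apply: reducesM; [apply: reduces_euler0 | apply: reduces_nat].
Qed.

Lemma reduces_bernoulli_alt_sum_inv0 :
  reduces ((p ^ r.-1)%N%:R * bernoulli (p - 3))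
    (cyclic_conv (@inv0 Zq) (@inv0 Zq) 1 *
       \sum_(i < p ^ r) (-1) ^+ i * inv0 i%:R ^+ 3).
Proof.
rewrite inv0_cyclic_conv1_ZpX -mulrA.
have p_gt2 := odd_prime_gt2 p_odd p_prime.
have [p3|p_neq3] := eqVneq p 3.
  rewrite (@socle_gen_alt_sum_inv0X _ 1) ?p3 // mulrA.
  by have := reduces_bernoulli_alt_power_sum_eq3 p3.
have p_gt3 : (3 < p)%N by rewrite ltn_neqAle eq_sym p_neq3.
have p_neq4 : p != 4 by apply: contraTneq p_odd => ->.
rewrite (@socle_gen_alt_sum_inv0X _ (p - 4)) //; last 2 first.
- by lia.
- by apply/dvdnP; exists 1; lia.
by rewrite mulrA; apply: reduces_bernoulli_alt_power_sum_gt3.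
Qed.

End PrimePowerModulus.

Theorem theorem1 (p r : nat) (hp : prime p) (hodd : odd p) (hr : (0 < r)%N) :
  eqmodp p r
    (\sum_(i < (2 * p ^ r).+1) \sum_(j < (2 * p ^ r).+1)
       \sum_(k < (2 * p ^ r).+1 |
             [&& (i + j + k == 2 * p ^ r)%N, coprime_pos p i,
                 coprime_pos p j & coprime_pos p k])
         ((-1) ^+ i / (i * j * k)%N%:R))
    ((p ^ (r - 1))%N%:R * bernoulli (p - 3)).
Proof.
have q_gt1 := pfactor_gt1 hp hr.
have q_odd := odd_pfactor r hodd.
have bernoulliE := reduces_bernoulli_alt_sum_inv0 hp hr hodd.
rewrite subn1; apply: (reduces_eqmodp q_gt1 hr _ bernoulliE).
rewrite -alt_sum_inv0_cauchy_product //.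
rewrite -(triple_sum_cauchy_product (fun i => (-1) ^+ i * inv0 i%:R)).
apply: reduces_sum => i _; apply: reduces_sum => j _.
rewrite big_mkcondr; apply: reduces_sum => k _ /=.
have coprimeE a : coprime_pos p a = (a%:R \is a @GRing.unit 'Z_(p ^ r)).
  rewrite unitr_natZpX // /coprime_pos /= coprime_sym prime_coprime //.
  by case: a => //; rewrite dvdn0.
rewrite -!mulrA -!inv0M -!natrM mulnA !coprimeE -!unitrM -!natrM mulnA /inv0.
case: ifP => [uijk|_]; last by rewrite mulr0; apply: (reduces_nat _ 0).
apply: reducesM; last by apply/reducesV/reduces_nat.
by apply/reducesX/reducesN/(reduces_nat _ 1).
Qed.
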